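(* For a computably enumerable set $A\subseteq\mathbb{N}$ the following are equivalent: (1) $2^{-A}$ is regainingly approximable. (2) There exists a computable $\mathrm{id}_{\mathbb{N}}$-good enumeration of $A$. (3) There exists a computable nondecreasing unbounded function $r\colon\mathbb{N}\to\mathbb{N}$ such that there exists a computable $r$-good enumeration of $A$. (4) For every computable enumeration $f$ of $A$ there exists a computable increasing function $r\colon\mathbb{N}\to\mathbb{N}$ such that $f$ is $r$-good.
   Context: For $D\subseteq\mathbb{N}$ let $2^{-D}:=\sum_{a\in D}2^{-(a+1)}$. A real number $\alpha$ is regainingly approximable if there exists a computable nondecreasing sequence of rational numbers $(a_n)_n$ converging to $\alpha$ with $\alpha-a_n<2^{-n}$ for infinitely many $n$. A total function $f\colon\mathbb{N}\to\mathbb{N}$ is an enumeration of $A$ if $A=\{n:\exists k\, f(k)=n+1\}$. $\mathrm{Enum}(f)[t]:=\{n:\exists k<t\, f(k)=n+1\}$. For a nondecreasing unbounded $r\colon\mathbb{N}\to\mathbb{N}$, an enumeration $f$ of $A$ is $r$-good if there are infinitely many $n$ with $\{0,\ldots,n-1\}\cap A\subseteq\mathrm{Enum}(f)[r(n)]$. $\mathrm{id}_{\mathbb{N}}$ is the identity function. *)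

(* Defs.v *)
From mathcomp Require Import all_boot all_order all_algebra.
From mathcomp Require Import all_classical all_reals all_analysis.

Set Implicit Arguments.
Unset Strict Implicit.
Unset Printing Implicit Defensive.

Import Order.TTheory GRing.Theory Num.Theory.
Import numFieldNormedType.Exports.

Local Open Scope classical_set_scope.
Local Open Scope nat_scope.

(* [murec n] is the type of programs for Kleene's n-ary partial recursive
   functions: basic functions, composition, primitive recursion (on the first
   argument) and unbounded minimization (over the first argument). *)
Inductive murec : nat -> Type :=
| Zero n : murec n
| Succ : murec 1
| Proj n (i : 'I_n) : murec n
| Comp m n (f : murec m) (g : 'I_m -> murec n) : murec n
| Prec n (f : murec n) (g : murec n.+2) : murec n.+1
| Mu n (f : murec n.+1) : murec n.

(* [murec_eval c v y]: the program [c] halts on input [v] with output [y]. *)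
Fixpoint murec_eval n (c : murec n) : n.-tuple nat -> nat -> Prop :=
  match c in murec n return n.-tuple nat -> nat -> Prop with
  | Zero n => fun v y => y = 0
  | Succ => fun v y => y = (thead v).+1
  | Proj n i => fun v y => y = tnth v i
  | Comp m n f g => fun v y =>
      exists w : m.-tuple nat,
        (forall i, murec_eval (g i) v (tnth w i)) /\ murec_eval f w y
  | Prec n f g => fun v y =>
      let w := [tuple of behead v] in
      (fix loop k y := match k with
       | 0 => murec_eval f w y
       | k'.+1 => exists z, loop k' z /\ murec_eval g [tuple of k' :: z :: w] y
       end) (thead v) y
  | Mu n f => fun v y =>
      murec_eval f [tuple of y :: v] 0 /\
      (forall z, z < y -> exists u, murec_eval f [tuple of z :: v] u.+1)
  end.

Definition computable (f : nat -> nat) : Prop :=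
  exists c : murec 1, forall x, murec_eval c [tuple x] (f x).

Definition computable_rat_seq (a : nat -> rat) : Prop :=
  exists p q d : nat -> nat,
    [/\ computable p, computable q, computable d &
        forall n, a n = (((p n)%:R - (q n)%:R) / (d n).+1%:R)%R].

Definition two_pow_neg (R : realType) (D : set nat) : R :=
  limn (fun n => \sum_(0 <= a < n | a \in D) (2 ^- a.+1 : R))%R.

Definition regainingly_approximable (R : realType) (alpha : R) : Prop :=
  exists a : nat -> rat,
    [/\ computable_rat_seq a,
        nondecreasing_seq a,
        (fun n => ratr (a n) : R) @ \oo --> alpha &
        infinite_set [set n : nat | (alpha - ratr (a n) < 2 ^- n)%R]].

(* The value 0 of [f] means that nothing is enumerated at that stage. *)
Definition enumeration (f : nat -> nat) (A : set nat) : Prop :=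
  A = [set n | exists k, f k = n.+1].

Definition computable_enumeration (f : nat -> nat) (A : set nat) : Prop :=
  computable f /\ enumeration f A.

Definition computably_enumerable (A : set nat) : Prop :=
  exists f, computable_enumeration f A.

Definition Enum (f : nat -> nat) (t : nat) : set nat :=
  [set n | exists2 k, k < t & f k = n.+1].

Definition unbounded_fun (r : nat -> nat) : Prop :=
  forall M, exists n, M < r n.

(* Used only for [f] an enumeration of [A] and [r] nondecreasing and
   unbounded. *)
Definition good (r f : nat -> nat) (A : set nat) : Prop :=
  infinite_set [set n | `I_n `&` A `<=` Enum f (r n)].

(* Main.v *)
(* (1) => (3): for a given computable enumeration f of A, wait until the finite
   stage t satisfies 2^-(Enum(f)[t]) >= a_(n+1) - 2^-(n+1).  When
   2^-A - a_(n+1) < 2^-(n+1), what is still missing from 2^-A is less than 2^-n,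
   so no element of A below n can appear after stage t.
   (3) => (2): if A is finite every enumeration works.  Otherwise call i released
   at m when i < m and i is in Enum(f)[r(m)], and list, for m = 0, 1, 2, ... in
   turn, the elements newly released at m, without repetition or pause.  At most
   m numbers are released at m, so all of them are listed within m steps; when m
   is good for f they are all the elements of A below m.
   (3) => (4): wait until the second enumeration has caught up with r(n) steps of
   the first one.
   (4) => (1): approximate 2^-A by the elements below n+1 enumerated within
   r(n+1) steps. *)
Require Import Defs.
From mathcomp Require Import all_boot all_order all_algebra.
From mathcomp Require Import all_classical all_reals all_analysis.
From mathcomp Require Import ring lra.

Set Implicit Arguments.
Unset Strict Implicit.
Unset Printing Implicit Defensive.

(** * Closure properties of the recursive functions *)

(* Nested pairs stand in for tuples so that substituting into the n-ary function
   [fun c => ... c.1 ... c.2.1 ...] is plain conversion. *)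
Fixpoint ctx (n : nat) : Type :=
  if n is n'.+1 then (nat * ctx n')%type else unit.

Fixpoint ctx_of (n : nat) (s : seq nat) : ctx n :=
  match n return ctx n with
  | 0 => tt
  | n'.+1 => (head 0 s, ctx_of n' (behead s))
  end.

Definition tuple_recursive n (F : n.-tuple nat -> nat) : Prop :=
  exists c : murec n, forall v, murec_eval c v (F v).

Definition recursive n (F : ctx n -> nat) : Prop :=
  tuple_recursive (fun v : n.-tuple nat => F (ctx_of n v)).

Lemma thead_head n (v : n.+1.-tuple nat) : thead v = head 0 v.
Proof. by case/tupleP: v => x v; rewrite theadE. Qed.

Lemma comp_ext n (F G : ctx n -> nat) : recursive F -> F =1 G -> recursive G.
Proof. by move=> [c cF] FG; exists c => v; rewrite -FG. Qed.

Lemma tuple_recursive_comp m n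
    (F : ctx m -> nat) (G : n.-tuple nat -> m.-tuple nat) :
  recursive F -> (forall i, tuple_recursive (fun v => tnth (G v) i)) ->
  tuple_recursive (fun v => F (ctx_of m (G v))).
Proof.
move=> [c cF] /choice[g cG]; exists (Comp c g) => v /=.
by exists (G v); split => [i|]; [exact: cG | exact: cF].
Qed.

Lemma comp_v0 n : recursive (fun c : ctx n.+1 => c.1).
Proof. by exists (Proj ord0) => v /=; rewrite (tnth_nth 0) nth0. Qed.

Lemma comp_subst n (F : ctx n.+1 -> nat) (K : ctx n -> nat) :
  recursive F -> recursive K -> recursive (fun c => F (K c, c)).
Proof.
move=> cF cK.
pose G (v : n.-tuple nat) := [tuple of K (ctx_of n v) :: v].
apply: (tuple_recursive_comp (G := G) cF) => i.
have [j|] := unliftP ord0 i => ->.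
  by exists (Proj j) => v; rewrite tnthS.
by have [c Hc] := cK; exists c => v; rewrite tnth0.
Qed.

Lemma comp_weak n (F : ctx n -> nat) :
  recursive F -> recursive (fun c : ctx n.+1 => F c.2).
Proof.
move=> cF; pose G (v : n.+1.-tuple nat) := [tuple of behead v].
apply: (tuple_recursive_comp (G := G) cF) => i.
by exists (Proj (lift ord0 i)) => v /=; rewrite !(tnth_nth 0) -nth_behead.
Qed.

(** The dropped slot is the one in which primitive recursion stores the previous value, so a summand
    can be used inside a step function. *)
Lemma comp_weak1 n (F : ctx n.+1 -> nat) :
  recursive F -> recursive (fun c : ctx n.+2 => F (c.1, c.2.2)).
Proof.
move=> cF.
pose G (v : n.+2.-tuple nat) := [tuple of head 0 v :: behead (behead v)].
apply: (tuple_recursive_comp (G := G) cF) => i.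
have [j|] := unliftP ord0 i => ->.
  exists (Proj (lift ord0 (lift ord0 j))) => v.
  by rewrite /= !(tnth_nth 0) /= -!nth_behead.
by exists (Proj ord0) => v; rewrite tnth0 /= (tnth_nth 0) nth0.
Qed.

Lemma comp_v1 n : recursive (fun c : ctx n.+2 => c.2.1).
Proof. exact: (comp_weak (@comp_v0 n)). Qed.

Lemma comp_v2 n : recursive (fun c : ctx n.+3 => c.2.2.1).
Proof. exact: (comp_weak (@comp_v1 n)). Qed.

Lemma computableE f : computable f <-> recursive (fun c : ctx 1 => f c.1).
Proof.
split=> -[c cf]; exists c; last by move=> x; exact: (cf [tuple x]).
by case/tupleP=> x v; rewrite (tuple0 v); exact: cf.
Qed.

Lemma comp_app1 f n (F : ctx n -> nat) :
  computable f -> recursive F -> recursive (fun c => f (F c)).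
Proof.
move=> /computableE cf cF.
pose G (v : n.-tuple nat) := [tuple F (ctx_of n v)].
apply: (tuple_recursive_comp (G := G) cf) => i.
by have [c Hc] := cF; exists c => v; rewrite (ord1 i) tnth0.
Qed.

Lemma comp_app2 (f : nat -> nat -> nat) n (F G : ctx n -> nat) :
  recursive (fun c : ctx 2 => f c.1 c.2.1) -> recursive F -> recursive G ->
  recursive (fun c => f (F c) (G c)).
Proof.
move=> cf cF cG.
pose FG (v : n.-tuple nat) := [tuple F (ctx_of n v); G (ctx_of n v)].
apply: (tuple_recursive_comp (G := FG) cf) => i.
have [j|] := unliftP ord0 i => ->.
  by have [c Hc] := cG; exists c => v; rewrite tnthS (ord1 j) tnth0.
by have [c Hc] := cF; exists c => v; rewrite tnth0.
Qed.

(** Shows an already defined function to be recursive by checking its recursion equation; [S] takes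
    its arguments in the order of [Prec]. *)
Lemma comp_rec n (H : nat -> ctx n -> nat) (S : ctx n.+2 -> nat) :
  recursive (H 0) -> recursive S ->
  (forall k c, H k.+1 c = S (k, (H k c, c))) ->
  recursive (fun c : ctx n.+1 => H c.1 c.2).
Proof.
move=> [b cb] [s cs] HS; exists (Prec b s) => v /=.
rewrite -thead_head; move: (thead v) => k.
elim: k => [|k IH]; first exact: (cb [tuple of behead v]).
exists (H k (ctx_of n (behead v))); split => //.
rewrite HS.
exact: (cs [tuple of k :: H k (ctx_of n (behead v)) :: [tuple of behead v]]).
Qed.

Lemma comp_mu n (P : nat -> ctx n -> bool) (G : ctx n -> nat) :
  recursive (fun c : ctx n.+1 => ~~ P c.1 c.2 : nat) ->
  (forall c, P (G c) c) -> (forall c m, P m c -> G c <= m) -> recursive G.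
Proof.
(* [Mu] searches for a zero, hence the negation in the hypothesis: below [G c] the program [p]
   returns 1, at [G c] it returns 0. *)
move=> [p cp] GP Gmin; exists (Mu p) => v /=; set c := ctx_of n v; split.
  by have := cp [tuple of G c :: v]; rewrite /= GP.
move=> z zG; exists 0; have := cp [tuple of z :: v]; rewrite /= -/c.
by case: (boolP (P z c)) => // /Gmin; rewrite leqNgt zG.
Qed.

Lemma computable_succ : computable succn.
Proof. by exists Succ => x. Qed.

Lemma comp_succ n (F : ctx n -> nat) :
  recursive F -> recursive (fun c => (F c).+1).
Proof. exact/comp_app1/computable_succ. Qed.

Lemma comp_const n k : recursive (fun _ : ctx n => k).
Proof. by elim: k => [|k /comp_succ//]; exists (Zero n). Qed.

Lemma comp_pred n (F : ctx n -> nat) :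
  recursive F -> recursive (fun c => (F c).-1).
Proof.
apply: comp_app1; apply/computableE.
apply: (comp_rec (H := fun k _ => k.-1) (comp_const 0 0) (comp_v0 1)) => //.
Qed.

Lemma comp_add n (F G : ctx n -> nat) :
  recursive F -> recursive G -> recursive (fun c => F c + G c).
Proof.
apply: comp_app2.
exact: (comp_rec (H := fun k (c : ctx 1) => k + c.1) (comp_v0 0)
          (comp_succ (comp_v1 1))).
Qed.

Lemma comp_mul n (F G : ctx n -> nat) :
  recursive F -> recursive G -> recursive (fun c => F c * G c).
Proof.
apply: comp_app2.
exact: (comp_rec (H := fun k (c : ctx 1) => k * c.1) (comp_const 1 0)
          (comp_add (comp_v2 0) (comp_v1 1))).
Qed.

Lemma comp_sub n (F G : ctx n -> nat) :
  recursive F -> recursive G -> recursive (fun c => F c - G c).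
Proof.
(* Truncated subtraction recurses on the subtrahend, and [Prec] on the first argument, so the
   arguments are swapped. *)
move=> cF cG; apply: (comp_app2 (f := fun k m => m - k) _ cG cF).
apply: (comp_rec (H := fun k (c : ctx 1) => c.1 - k) _
          (comp_pred (comp_v1 1))) => [|k c]; last exact: subnS.
by apply: comp_ext (comp_v0 0) _ => c; rewrite subn0.
Qed.

Lemma comp_exp n k (F : ctx n -> nat) :
  recursive F -> recursive (fun c => k ^ F c).
Proof.
apply: comp_app1; apply/computableE.
apply: (comp_rec (H := fun m _ => k ^ m) (comp_const 0 1)
          (comp_mul (comp_const 2 k) (comp_v1 0))) => m c; exact: expnS.
Qed.

Lemma comp_sum n (F : nat -> ctx n -> nat) (K : ctx n -> nat) :
  recursive (fun c : ctx n.+1 => F c.1 c.2) -> recursive K ->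
  recursive (fun c => \sum_(i < K c) F i c).
Proof.
move=> cF cK.
apply: (comp_subst (F := fun c => \sum_(i < c.1) F i c.2)) cK.
apply: (comp_rec (H := fun k c => \sum_(i < k) F i c) _
         (comp_add (comp_v1 n) (comp_weak1 cF))) => [|k c].
  by apply: comp_ext (comp_const n 0) _ => c; rewrite big_ord0.
by rewrite big_ord_recr.
Qed.

(** The truth value is [1 - (F c - G c)] in truncated subtraction. *)
Lemma comp_leq n (F G : ctx n -> nat) :
  recursive F -> recursive G -> recursive (fun c => F c <= G c : nat).
Proof.
move=> cF cG; apply: comp_ext (comp_sub (comp_const n 1) (comp_sub cF cG)) _.
by move=> c; rewrite -subn_eq0; case: (F c - G c).
Qed.

Lemma comp_neg n (P : ctx n -> bool) :
  recursive (fun c => P c : nat) -> recursive (fun c => ~~ P c : nat).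
Proof.
move=> cP; apply: comp_ext (comp_sub (comp_const n 1) cP) _.
by move=> c; case: (P c).
Qed.

Lemma comp_and n (P Q : ctx n -> bool) :
  recursive (fun c => P c : nat) -> recursive (fun c => Q c : nat) ->
  recursive (fun c => P c && Q c : nat).
Proof.
move=> cP cQ; apply: comp_ext (comp_mul cP cQ) _ => c.
by rewrite mulnb.
Qed.

Lemma comp_eq n (F G : ctx n -> nat) :
  recursive F -> recursive G -> recursive (fun c => F c == G c : nat).
Proof.
move=> cF cG; apply: comp_ext (comp_and (comp_leq cF cG) (comp_leq cG cF)) _.
by move=> c; rewrite eqn_leq.
Qed.

Lemma comp_exists n (P : nat -> ctx n -> bool) (K : ctx n -> nat) :
  recursive (fun c : ctx n.+1 => P c.1 c.2 : nat) -> recursive K ->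
  recursive (fun c => [exists i : 'I_(K c), P i c] : nat).
Proof.
move=> cP cK.
have cS := comp_sum (F := fun i c => P i c) cP cK.
apply: comp_ext (comp_leq (comp_const n 1) cS) _ => c.
congr nat_of_bool; rewrite lt0n sum_nat_eq0 negb_forall.
by apply: eq_existsb => i; case: (P i c).
Qed.

(** All later searches use this lemma. Leastness of the witness also makes the stages found below
    monotone. *)
Lemma computable_min (P : nat -> nat -> bool) :
  recursive (fun c : ctx 2 => P c.1 c.2.1 : nat) ->
  (forall x, exists m, P m x) ->
  exists g, [/\ computable g, forall x, P (g x) x &
                forall x m, P m x -> g x <= m].
Proof.
move=> cP exP; pose g x := ex_minn (exP x).
have gP x : P (g x) x /\ forall m, P m x -> g x <= m.
  by rewrite /g; case: ex_minnP.
exists g; split=> [|x|x m]; [|by case: (gP x)|by case: (gP x) => _; apply].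
apply/computableE.
apply: (comp_mu (P := fun m (c : ctx 1) => P m c.1)) => [|c|c].
- exact: comp_neg.
- by case: (gP c.1).
- by case: (gP c.1).
Qed.

(** * Finite stages of enumerations *)

Section Enumerations.
Local Open Scope classical_set_scope.

Lemma infinite_natP (P : set nat) :
  infinite_set P <-> forall n, exists2 m, n <= m & P m.
Proof.
split=> [Pinf n|Pge /finite_seqP[X PX]].
  apply: contrapT => Pn; apply: Pinf.
  apply: sub_finite_set (finite_II n) => m Pm.
  by rewrite /= ltnNge; apply/negP => nm; apply: Pn; exists m.
have [m Xm Pm] := Pge (\max_(x <- X) x).+1.
have : m \in X by move: Pm; rewrite PX.
move=> mX; have := leq_bigmax_seq (P := xpredT) (F := id) m mX isT.
by rewrite leqNgt Xm.
Qed.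

Definition listed (f : nat -> nat) (t i : nat) : bool :=
  [exists k : 'I_t, f k == i.+1].

Lemma listedP f t i : reflect (Enum f t i) (listed f t i).
Proof.
apply: (iffP existsP) => [[k /eqP fk]|[k kt fk]]; first by exists k.
by exists (Ordinal kt); apply/eqP.
Qed.

Lemma Enum_mono f s t : s <= t -> Enum f s `<=` Enum f t.
Proof. by move=> st i [k ks fk]; exists k => //; apply: leq_trans st. Qed.

Lemma listed_mono f s t i : s <= t -> listed f s i -> listed f t i.
Proof. by move=> st /listedP/(Enum_mono st)/listedP. Qed.

Lemma enumeration_Enum f A t : enumeration f A -> Enum f t `<=` A.
Proof. by move=> -> i [k _ fk]; exists k. Qed.

(** Finitely many elements each appear at some stage, and the largest of these stages serves all.
    Such stages make the searches below terminate. *)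
Lemma enumeration_section f A n :
  enumeration f A -> exists t, `I_n `&` A `<=` Enum f t.
Proof.
move=> fA; elim: n => [|n [t nt]]; first by exists 0 => i [].
have [An|An] := pselect (A n).
  have [k fk] : exists k, f k = n.+1 by move: An; rewrite fA.
  exists (maxn t k.+1) => i /= [].
  rewrite ltnS leq_eqVlt => /predU1P[-> _|ni Ai].
    by exists k => //; rewrite leq_max ltnSn orbT.
  by apply: (Enum_mono (leq_maxl t k.+1)); apply: nt.
exists t => i /= []; rewrite ltnS leq_eqVlt => /predU1P[->//|ni Ai].
exact: nt.
Qed.

Lemma comp_listed f n (T I : ctx n -> nat) :
  computable f -> recursive T -> recursive I ->
  recursive (fun c => listed f (T c) (I c)).
Proof.
move=> cf cT cI.
apply: (comp_exists (P := fun k c => f k == (I c).+1)) => //.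
apply: comp_eq; first exact: comp_app1 cf (comp_v0 _).
exact/comp_succ/comp_weak.
Qed.

(** * Repacking an [r]-good enumeration of an infinite set into an [id]-good one *)

Section Repacking.
Variables (A : set nat) (f r : nat -> nat).
Hypotheses (cf : computable f) (cr : computable r) (fA : enumeration f A).
Hypotheses (r_homo : {homo r : m n / m <= n}) (fgood : good r f A).

Let released m i := (i < m) && listed f (r m) i.
(** The default [0.-1 = 0] does no harm: nothing is released at 0. *)
Let fresh m i := released m i && ~~ released m.-1 i.
Let count m := \sum_(i < m) released m i.

Let released_mono m n i : m <= n -> released m i -> released n i.
Proof.
move=> mn /andP[im fi]; rewrite /released (leq_trans im mn) /=.
by apply: listed_mono fi; apply: r_homo.
Qed.

Let releasedA m i : released m i -> A i.
Proof. by case/andP => _ /listedP; apply: enumeration_Enum. Qed.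

Let released_good n : `I_n `&` A `<=` Enum f (r n) ->
  forall i, i < n -> A i -> released n i.
Proof. by move=> gn i ni Ai; rewrite /released ni; apply/listedP/gn. Qed.

(** Released numbers are below [m], so the range can be enlarged; counts at different stages can
    then be compared term by term. *)
Let countW m k : m <= k -> count m = \sum_(i < k) released m i.
Proof.
move=> mk; rewrite /count (big_ord_widen k (fun i => released m i : nat) mk).
rewrite big_mkcond /=; apply: eq_bigr => i _.
by rewrite /released; case: ltnP.
Qed.

Let count_mono m n : m <= n -> count m <= count n.
Proof.
move=> mn; rewrite (countW mn); apply: leq_sum => i _.
by case: (boolP (released m i)) => // /(released_mono mn) ->.
Qed.

Let count_le m : count m <= m.
Proof.
rewrite -[leqRHS]card_ord -sum1_card; apply: leq_sum => i _.
exact: leq_b1.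
Qed.

(** Since release is permanent, the numbers released at [m] split into those released at [m.-1] and
    the fresh ones. *)
Let countS m k : m <= k -> count m = count m.-1 + \sum_(i < k) fresh m i.
Proof.
move=> mk; rewrite (countW mk) (countW (leq_trans (leq_pred m) mk)) -big_split.
apply: eq_bigr => i _ /=; rewrite /fresh.
have := @released_mono m.-1 m i (leq_pred m).
by case: (released m.-1 i) => [->|_]; rewrite ?andbT ?addn0 ?andbF.
Qed.

Let comp_released n (M I : ctx n -> nat) :
  recursive M -> recursive I ->
  recursive (fun c => released (M c) (I c) : nat).
Proof.
move=> cM cI; apply: comp_and; first exact/comp_leq/cM/comp_succ.
exact/comp_listed/cI/comp_app1.
Qed.

Let comp_fresh n (M I : ctx n -> nat) :
  recursive M -> recursive I ->
  recursive (fun c => fresh (M c) (I c) : nat).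
Proof.
move=> cM cI; apply: comp_and; first exact: comp_released.
exact/comp_neg/comp_released/cI/comp_pred.
Qed.

Let comp_count n (M : ctx n -> nat) :
  recursive M -> recursive (fun c => count (M c)).
Proof.
move=> cM; apply: (comp_sum (F := fun i c => released (M c) i)) => //.
by apply: comp_released (comp_v0 _); apply: comp_weak.
Qed.

Let count_unbounded : infinite_set A -> forall k, exists m, k < count m.
Proof.
move=> /infinite_natP Ainf; elim=> [|k [m km]].
  have [x _ Ax] := Ainf 0.
  have [n xn gn] := (infinite_natP _).1 fgood x.+1.
  exists n; rewrite /count (bigD1 (Ordinal xn)) //=.
  by rewrite (released_good gn).
(* As [x >= m], it is not released at [m]; a good [n] above [x] releases it and raises the count. *)
have [x mx Ax] := Ainf m.
have [n xn gn] := (infinite_natP _).1 fgood x.+1.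
have mn : m <= n by rewrite (leq_trans mx) // ltnW.
exists n; apply: (leq_ltn_trans km).
rewrite (countW mn) /count (bigD1 (Ordinal xn)) //=.
rewrite [ltnRHS](bigD1 (Ordinal xn)) //=.
rewrite (released_good gn xn Ax) {1}/released (leq_gtF mx) /= add0n add1n ltnS.
apply: leq_sum => i _.
by case: (boolP (released m i)) => // /(released_mono mn) ->.
Qed.

Lemma good_id_of_infinite : infinite_set A ->
  exists g, computable_enumeration g A /\ good id g A.
Proof.
move=> Ainf.
(* [M k] is the stage whose block of fresh numbers contains position [k] of the new list. *)
have [M [cM Mgt Mmin]] : exists M, [/\ computable M,
    forall k, k < count (M k) & forall k m, k < count m -> M k <= m].
  apply: (computable_min (P := fun m k => k < count m)).
    by apply: comp_leq (comp_count (comp_v0 _)); apply: comp_succ (comp_v1 _).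
  exact: count_unbounded.
have Mpred k : count (M k).-1 <= k.
  rewrite leqNgt; apply/negP => /Mmin; have := Mgt k.
  case: (M k) => [|m _]; last by rewrite ltnn.
  by rewrite /count big_ord0.
(* The k-th number listed is the I k released at M k: [count (M k).-1] numbers
   come before that block, in which I k is preceded by smaller fresh ones. *)
pose Q i k := k < count (M k).-1 + \sum_(j < i.+1) fresh (M k) j.
have [I [cI Igt Imin]] : exists I, [/\ computable I,
    forall k, Q (I k) k & forall k i, Q i k -> I k <= i].
  apply: computable_min.
    apply: comp_leq; first exact: comp_succ (comp_v1 _).
    have cMk n : recursive (fun c : ctx n.+2 => M c.2.1).
      exact: comp_app1 (comp_v1 _).
    apply: comp_add; first exact/comp_count/comp_pred.
    apply: (comp_sum (F := fun j (c : ctx 2) => fresh (M c.2.1) j)).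
      exact: comp_fresh (comp_weak (cMk _)) (comp_v0 _).
    exact: comp_succ (comp_v0 _).
  (* The sum over [j < (M k).+1] takes in every fresh number, so the total is [count (M k)], which
     exceeds [k]. *)
  by move=> k; exists (M k); rewrite /Q -countS.
(* Were [I k] not fresh, its summand would vanish and its predecessor would already satisfy [Q]; for
   [I k = 0] this contradicts [Mpred]. *)
have Ifresh k : fresh (M k) (I k).
  apply: contraT => /negbTE nf.
  have := Igt k; rewrite /Q big_ord_recr /= nf addn0.
  case E : (I k) => [|i]; first by rewrite big_ord0 addn0 ltnNge Mpred.
  by move=> /Imin; rewrite E ltnn.
have released_listed n i : released n i -> Enum (fun k => (I k).+1) n i.
  move=> rni.
  have [m rmi mmin] := ex_minnP (ex_intro (fun m => released m i) n rni).
  have mn : m <= n by apply: mmin.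
  have fmi : fresh m i.
    rewrite /fresh rmi /=; apply/negP => /mmin.
    by case: m rmi {mmin mn} => [//|m _]; rewrite ltnn.
  have im : i < m by case/andP: rmi.
  (* The position of [i] in the list: everything released before its first stage [m], then the
     smaller fresh numbers of that block. *)
  pose k := count m.-1 + \sum_(j < i) fresh m j.
  have kS : k < count m.-1 + \sum_(j < i.+1) fresh m j.
    by rewrite big_ord_recr /= fmi addn1 addnS.
  have km : k < count m.
    rewrite (countS (leqnn m)) (leq_trans kS) // leq_add2l.
    rewrite (big_ord_widen m (fun j => fresh m j : nat) im).
    by rewrite [leqRHS](bigID (fun j : 'I_m => j < i.+1)) /= leq_addr.
  (* An earlier block would end by [count m.-1], which is at most [k]. *)
  have Mk : M k = m.
    apply/eqP; rewrite eqn_leq Mmin //= leqNgt; apply/negP => Mm.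
    have : count (M k) <= count m.-1 by apply: count_mono; case: (m) Mm.
    by move=> /(leq_trans (Mgt k)); rewrite /k ltnNge leq_addr.
  (* The source of [id]-goodness: [k < count m <= count n <= n]. *)
  exists k; first exact: leq_trans km (leq_trans (count_mono mn) (count_le n)).
  congr _.+1; apply/eqP; rewrite eqn_leq Imin /Q ?Mk //= leqNgt.
  apply/negP => Ii.
  have := Igt k; rewrite /Q Mk /k ltn_add2l ltnNge => /negP; apply.
  rewrite (big_ord_widen i (fun j => fresh m j : nat) Ii).
  by rewrite [leqRHS](bigID (fun j : 'I_i => j < (I k).+1)) /= leq_addr.
have good_listed n : `I_n `&` A `<=` Enum f (r n) ->
    `I_n `&` A `<=` Enum (fun k => (I k).+1) n.
  by move=> gn i [ni Ai]; apply/released_listed/released_good.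
exists (fun k => (I k).+1); split; last first.
  apply/infinite_natP => n; have [m nm gm] := (infinite_natP _).1 fgood n.
  by exists m => //; apply: good_listed.
split.
  by apply/computableE/comp_succ/computableE.
rewrite /enumeration eqEsubset; split=> [x Ax|x [k [<-]]].
  have [n xn gn] := (infinite_natP _).1 fgood x.+1.
  by have [k _ kx] := good_listed _ gn x (conj xn Ax); exists k.
by have /andP[/releasedA] := Ifresh k.
Qed.

End Repacking.

(** Once all of [A] has appeared, every later index is good. *)
Lemma good_id_of_finite A f : finite_set A -> enumeration f A -> good id f A.
Proof.
move=> Afin fA; apply/infinite_natP => n.
have [b bA] : exists b, A `<=` `I_b.
  apply: contrapT => nA; suff : infinite_set A by [].
  apply/infinite_natP => b; apply: contrapT => bA; apply: nA; exists b => x Ax.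
  by rewrite /= ltnNge; apply/negP => bx; apply: bA; exists x.
have [t bt] := enumeration_section b fA.
exists (maxn n t); first exact: leq_maxl.
move=> x [_ Ax]; apply: (Enum_mono (leq_maxr n t)); apply: bt; split => //.
exact: bA.
Qed.

End Enumerations.

(** * Transfer of goodness to another enumeration *)

Lemma good_transfer A f g r :
  enumeration f A -> computable_enumeration g A -> computable f ->
  computable r -> {homo r : m n / m <= n} -> good r f A ->
  exists r', [/\ computable r', {homo r' : m n / m < n} & good r' g A].
Proof.
move=> fA [cg gA] cf cr r_homo fgood.
(* The test [0 < f k] skips the stages at which [f] lists nothing. *)
pose missed t k := (0 < f k) && ~~ listed g t (f k).-1.
pose P t n := ~~ [exists k : 'I_(r n), missed t k].
have exP n : exists t, P t n.
  (* If [f k = i.+1] with [k < r n], then [i] lies below this maximum. *)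
  have [t tP] := enumeration_section (\max_(k < r n) f k) gA.
  exists t; apply/existsPn => k; rewrite negb_and negbK.
  case fk : (f k) => [//|i] /=; apply/listedP/tP; split.
    by rewrite /= -ltnS -fk ltnS leq_bigmax.
  by rewrite fA; exists k.
have [|t [ct tP tmin]] := computable_min (P := P) _ exP.
  apply: comp_neg; apply: (comp_exists (P := fun k (c : ctx 2) => missed c.1 k)).
    have cfk : recursive (fun c : ctx 3 => f c.1).
      exact: comp_app1 (comp_v0 _).
    apply: comp_and; first exact: comp_leq (comp_const _ _) cfk.
    exact/comp_neg/comp_listed/comp_pred/cfk/comp_v1.
  exact: comp_app1 (comp_v1 _).
have t_homo m n : m <= n -> t m <= t n.
  move=> mn; apply: tmin; apply/existsPn => k.
  by have /existsPn/(_ (widen_ord (r_homo _ _ mn) k)) := tP n.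
(* [t] is only nondecreasing; the summand [n] makes the function strictly increasing. *)
exists (fun n => n + t n); split.
- apply/computableE/comp_add; first exact: comp_v0.
  exact/computableE.
- by move=> m n mn; rewrite -addSn leq_add // t_homo // ltnW.
apply: sub_infinite_set fgood => n gn x /gn[k kr fk].
have /existsPn/(_ (Ordinal kr)) := tP n.
rewrite /missed /= fk /= negbK => /listedP; apply: Enum_mono.
exact: leq_addl.
Qed.

(** * Dyadic partial sums of the reals [two_pow_neg R D] *)

(** Over the denominator [2 ^ n] this is the partial sum below [n] for [Enum f t], as [psum_Enum]
    shows; computations thus stay within natural numbers. *)
Definition numerator f n t : nat :=
  \sum_(i < n) listed f t i * 2 ^ (n - i.+1).

Lemma comp_numerator f n (N T : ctx n -> nat) :
  computable f -> recursive N -> recursive T ->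
  recursive (fun c => numerator f (N c) (T c)).
Proof.
move=> cf cN cT.
apply: (comp_sum (F := fun i c => listed f (T c) i * 2 ^ (N c - i.+1))) => //.
apply: comp_mul; first exact/comp_listed/comp_v0/comp_weak.
by apply/comp_exp/comp_sub; [exact: comp_weak|exact/comp_succ/comp_v0].
Qed.

Section Regaining.
Import Order.TTheory GRing.Theory Num.Theory.
Import numFieldNormedType.Exports.
Local Open Scope classical_set_scope.
Local Open Scope ring_scope.
Variable R : realType.

Definition partial_two_pow_neg (D : set nat) (n : nat) : R :=
  \sum_(0 <= a < n | a \in D) 2 ^- a.+1.

Local Notation psum := partial_two_pow_neg.

Lemma psum_mkcond D n :
  psum D n = \sum_(i < n) (if (i : nat) \in D then 2 ^- i.+1 else 0).
Proof. by rewrite /psum big_mkcond big_mkord. Qed.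

Lemma psum_recr D n :
  psum D n.+1 = psum D n + (if n \in D then 2 ^- n.+1 else 0).
Proof. by rewrite !psum_mkcond big_ord_recr. Qed.

Lemma expVr2_half n : 2 ^- n = 2 ^- n.+1 + 2 ^- n.+1 :> R.
Proof. by rewrite exprS invfM; lra. Qed.

(** The upper bound is the full geometric sum between [n] and [n + k]; its subtracted term is what
    lets the induction go through. *)
Lemma psum_tail D n k : 0 <= psum D (n + k) - psum D n <= 2 ^- n - 2 ^- (n + k).
Proof.
elim: k => [|k IH]; first by rewrite addn0 !subrr lexx.
have e0 : 0 <= 2 ^- (n + k).+1 :> R by rewrite invr_ge0 exprn_ge0.
have := expVr2_half (n + k); move: IH e0; rewrite addnS psum_recr.
by case: ifP => _; lra.
Qed.

Lemma psum_homo D : nondecreasing_seq (psum D).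
Proof.
move=> m n /subnKC <-.
by have := psum_tail D m (n - m)%N; lra.
Qed.

Lemma psum_ub D n k : psum D k <= psum D n + 2 ^- n.
Proof.
have [nk|/ltnW/psum_homo kn] := leqP n k.
  have := psum_tail D n (k - n)%N; rewrite subnKC // => /andP[_].
  have : 0 <= 2 ^- k :> R by rewrite invr_ge0 exprn_ge0.
  lra.
by apply: (le_trans (kn D)); rewrite lerDl invr_ge0 exprn_ge0.
Qed.

Lemma is_cvg_psum D : cvgn (psum D).
Proof.
apply: nondecreasing_is_cvgn; first exact: psum_homo.
by exists (psum D 0 + 2 ^- 0) => _ [k _ <-]; exact: psum_ub.
Qed.

Lemma psum_le_two_pow_neg D n : psum D n <= two_pow_neg R D.
Proof. exact: nondecreasing_cvgn_le (@psum_homo D) (@is_cvg_psum D) n. Qed.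

Lemma two_pow_neg_le_psum D n : two_pow_neg R D <= psum D n + 2 ^- n.
Proof.
apply: limr_le; first exact: is_cvg_psum.
by apply: nearW => k; exact: psum_ub.
Qed.

Lemma psum_subset D E m n : (m <= n)%N -> `I_m `&` D `<=` E ->
  psum D m <= psum E n.
Proof.
move=> mn DE; apply: le_trans (psum_homo E mn).
rewrite !psum_mkcond; apply: ler_sum => i _.
case: ifPn => [/set_mem Di|_].
  by rewrite (mem_set (DE i (conj (ltn_ord i) Di))).
by case: ifP => // _; rewrite invr_ge0 exprn_ge0.
Qed.

(** At length [maxn n x.+1] both sums have reached [x], and its term occurs only for [E]. *)
Lemma psum_missing D E n x : D `<=` E -> E x -> ~ D x ->
  psum D n + 2 ^- x.+1 <= two_pow_neg R E.
Proof.
move=> DE Ex Dx; apply: le_trans (psum_le_two_pow_neg E (maxn n x.+1)).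
have xN : (x < maxn n x.+1)%N by rewrite leq_max ltnSn orbT.
apply: (@le_trans _ _ (psum D (maxn n x.+1) + 2 ^- x.+1)).
  by rewrite lerD2r psum_homo // leq_maxl.
rewrite !psum_mkcond (bigD1 (Ordinal xN)) //= [leRHS](bigD1 (Ordinal xN)) //=.
rewrite (memNset Dx) (mem_set Ex) add0r addrC lerD2r; apply: ler_sum => i _.
case: ifPn => [/set_mem/DE/mem_set ->//|_].
by case: ifP => // _; rewrite invr_ge0 exprn_ge0.
Qed.

Lemma psum_Enum f n t :
  psum (Enum f t) n = (numerator f n t)%:R / 2 ^+ n.
Proof.
rewrite psum_mkcond natr_sum mulr_suml; apply: eq_bigr => i _.
have -> : ((i : nat) \in Enum f t) = listed f t i.
  by apply/idP/idP => [/set_mem/listedP|/listedP/mem_set].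
case: listed; last by rewrite mul0n mul0r.
have -> : 2 ^+ n = 2 ^+ (n - i.+1) * 2 ^+ i.+1 :> R by rewrite -exprD subnK.
by rewrite mul1n natrX invfM mulrA divff ?mul1r // expf_neq0.
Qed.

Lemma expVr2_le m n : (m <= n)%N -> 2 ^- n <= 2 ^- m :> R.
Proof. by move=> mn; rewrite -!exprVn ler_wiXn2l //; lra. Qed.

(** * Regaining approximations and good enumerations *)

Lemma good_of_regaining A f :
  regainingly_approximable (two_pow_neg R A) -> computable_enumeration f A ->
  exists r, [/\ computable r, {homo r : m n / (m <= n)%N}, unbounded_fun r &
                good r f A].
Proof.
move=> [a [[p [q [d [cp cq cd aE]]]] a_homo a_cvg regain]] [cf fA].
(* [PE] below, with the denominators cleared. *)
pose P t n := (p n.+1 * (2 ^ t * 2 ^ n.+1) <=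
  numerator f t t * 2 ^ n.+1 * (d n.+1).+1 + 2 ^ t * (d n.+1).+1
  + q n.+1 * (2 ^ t * 2 ^ n.+1))%N.
have PE t n : P t n = (ratr (a n.+1) <= psum (Enum f t) t + 2 ^- n.+1).
  have D0 : 0 < 2 ^+ t * 2 ^+ n.+1 * (d n.+1).+1%:R :> R.
    by rewrite !mulr_gt0 ?exprn_gt0.
  rewrite psum_Enum aE fmorph_div rmorphB /= !ratr_nat -(ler_pM2r D0).
  rewrite /P -(ler_nat R) !(natrD, natrM, natrX) -lerBlDr.
  have d0 : (d n.+1).+1%:R != 0 :> R by rewrite pnatr_eq0.
  have n0 k : 2 ^+ k != 0 :> R by rewrite expf_neq0.
  move: (d n.+1).+1%:R d0 (2 ^+ t) (n0 t) (2 ^+ n.+1) (n0 n.+1).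
  move=> D d0 T t0 N N0.
  by congr (_ <= _); field; rewrite ?d0 ?t0 ?N0.
have a_le n : ratr (a n) <= two_pow_neg R A.
  have ra_homo : nondecreasing_seq (fun n => ratr (a n) : R).
    by move=> i j ij; rewrite ler_rat a_homo.
  rewrite -(cvg_lim _ a_cvg) //; apply: nondecreasing_cvgn_le n => //.
  by apply/cvg_ex; exists (two_pow_neg R A).
have exP n : exists t, P t n.
  (* When all elements of [A] below [n.+1] have appeared, the rest of the sum is at most
     [2 ^- n.+1]. *)
  have [t At] := enumeration_section n.+1 fA.
  exists (maxn t n.+1); rewrite PE; apply: le_trans (a_le _) _.
  apply: le_trans (two_pow_neg_le_psum A n.+1) _; rewrite lerD2r.
  apply: psum_subset; first exact: leq_maxr.
  exact: subset_trans At (Enum_mono (leq_maxl _ _)).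
have [|t [ct tP tmin]] := computable_min (P := P) _ exP.
  have c0 : recursive (fun c : ctx 2 => c.1) by exact: comp_v0.
  have c1 : recursive (fun c : ctx 2 => c.2.1.+1).
    exact/comp_succ/comp_v1.
  have c2 : recursive (fun c : ctx 2 => 2 ^ c.1)%N by exact: comp_exp.
  have c3 : recursive (fun c : ctx 2 => 2 ^ c.2.1.+1)%N by exact: comp_exp.
  have cdn : recursive (fun c : ctx 2 => (d c.2.1.+1).+1).
    by apply: comp_succ; apply: comp_app1.
  apply: comp_leq; first by apply: comp_mul; [exact: comp_app1|exact: comp_mul].
  apply: comp_add; last by apply: comp_mul; [exact: comp_app1|exact: comp_mul].
  apply: comp_add; last exact: comp_mul.
  by apply: comp_mul => //; apply: comp_mul => //; exact: comp_numerator.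
have t_homo m n : (m <= n)%N -> (t m <= t n)%N.
  move=> mn; apply: tmin; rewrite PE; have := tP n; rewrite PE => tPn.
  apply: (@le_trans _ _ (ratr (a n.+1))); first by rewrite ler_rat a_homo.
  by apply: (le_trans tPn); rewrite lerD2l expVr2_le.
(* [t] may be bounded; the summand [n] ensures unboundedness, and a later stage preserves
   goodness. *)
exists (fun n => n + t n)%N; split.
- apply/computableE/comp_add; first exact: comp_v0.
  exact/computableE.
- by move=> m n mn; rewrite leq_add // t_homo.
- by move=> M; exists M.+1; exact: leq_addr.
apply/infinite_natP => k.
have [[//|n] kn regain_n] := (infinite_natP _).1 regain k.+1; exists n => //.
move=> x [/= xn Ax]; apply: (Enum_mono (leq_addl n (t n))).
(* A missing [x < n] would leave a deficit of at least [2 ^- x.+1 >= 2 ^- n], but the two errors,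
   each tied to [2 ^- n.+1], sum to less than [2 ^- n]. *)
apply: contrapT => nx.
have := psum_missing (t n) (enumeration_Enum (t := t n) fA) Ax nx.
have := tP n; rewrite PE; move: regain_n => /=.
have := expVr2_half n; have := expVr2_le xn.
lra.
Qed.

Lemma regaining_of_good A f r :
  computable_enumeration f A -> computable r -> {homo r : m n / (m < n)%N} ->
  good r f A -> regainingly_approximable (two_pow_neg R A).
Proof.
move=> [cf fA] cr r_lt fgood.
(* The shift to [n.+1] gives error at most [2 ^- n.+1] when [n.+1] is good, hence the strict bound
   by [2 ^- n]. *)
pose a n : rat := (numerator f n.+1 (r n.+1))%:R / (2 ^ n.+1)%:R.
have aE n : ratr (a n) = psum (Enum f (r n.+1)) n.+1.
  by rewrite psum_Enum fmorph_div /= !ratr_nat natrX.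
have a_homo : nondecreasing_seq a.
  move=> m n mn; rewrite -(ler_rat R) !aE; apply: psum_subset => //.
  by move=> x [_]; apply: Enum_mono; rewrite (ltnW_homo r_lt).
have a_le n : ratr (a n) <= two_pow_neg R A.
  rewrite aE; apply: le_trans (psum_le_two_pow_neg _ n.+1).
  by apply: psum_subset => // x [_]; apply: enumeration_Enum.
have a_ge n : `I_n.+1 `&` A `<=` Enum f (r n.+1) ->
    two_pow_neg R A - ratr (a n) <= 2 ^- n.+1.
  move=> gn; rewrite aE lerBlDl; apply: le_trans (two_pow_neg_le_psum A n.+1) _.
  by rewrite lerD2r psum_subset.
have good_ge k : exists2 n, (k <= n)%N & `I_n.+1 `&` A `<=` Enum f (r n.+1).
  by have [[|n] kn gn] := (infinite_natP _).1 fgood k.+1 => //; exists n.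
exists a; split=> //.
- exists (fun n => numerator f n.+1 (r n.+1)), (fun=> 0%N),
    (fun n => (2 ^ n.+1).-1)%N; split.
  + have cS : recursive (fun c : ctx 1 => c.1.+1) by exact/comp_succ/comp_v0.
    by apply/computableE/comp_numerator => //; exact: comp_app1.
  + exact/computableE/comp_const.
  + exact/computableE/comp_pred/comp_exp/comp_succ/comp_v0.
  + by move=> n; rewrite subr0 prednK ?expn_gt0.
- apply/cvgrPdist_le => e e0.
  (* One good index beyond [N] suffices, since by monotonicity the error never grows again. *)
  have [N _ Ne] := near_infty_natSinv_expn_lt (PosNum e0).
  have [n Nn gn] := good_ge N; exists n => // k /= nk.
  rewrite ger0_norm ?subr_ge0 //.
  apply: (@le_trans _ _ (2 ^- n.+1)).
    apply: le_trans (a_ge _ gn); rewrite lerD2l lerN2 ler_rat a_homo //.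
  by have := Ne n.+1 (leqW Nn); rewrite /= div1r => /ltW.
apply/infinite_natP => k; have [n kn gn] := good_ge k; exists n => //=.
apply: le_lt_trans (a_ge _ gn) _.
have : 0 < 2 ^- n.+1 :> R by rewrite invr_gt0 exprn_gt0.
by have := expVr2_half n; lra.
Qed.

End Regaining.

Theorem theorem4p7 (R : realType) (A : set nat)
    (hA : computably_enumerable A) :
  [<-> regainingly_approximable (two_pow_neg R A);
       exists f, computable_enumeration f A /\ good id f A;
       exists r,
         [/\ computable r, {homo r : m n / (m <= n)%N}, unbounded_fun r &
             exists f, computable_enumeration f A /\ good r f A];
       forall f, computable_enumeration f A ->
         exists r, [/\ computable r, {homo r : m n / (m < n)%N} & good r f A]].
Proof.
have [f0 f0A] := hA.
split=> [regain|].
  have [r [cr r_homo _ f0r]] := good_of_regaining regain f0A.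
  (* The split need not be effective, because only the existence of a computable enumeration is
     claimed. *)
  have [Afin|Ainf] := pselect (finite_set A).
    by exists f0; split => //; apply: good_id_of_finite => //; case: f0A.
  by case: f0A => cf0 f0A; exact: good_id_of_infinite f0r Ainf.
split=> [[f [fA fid]]|].
  exists id; split=> //; [|by move=> M; exists M.+1|by exists f].
  exact/computableE/comp_v0.
split=> [[r [cr r_homo _ [f [[cf fA] fr]]]] g gA|all_good].
  exact: good_transfer fr.
have [r [cr r_homo f0r]] := all_good f0 f0A.
exact: regaining_of_good f0r.
Qed.
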